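(* The polynomials $P_{-4,n}$ are non-classical orthogonal polynomials; that is, the sequence $\{q_n\}_{n\ge 0}$, $q_n=P_{-4,2n}$, is a sequence of orthogonal polynomials with respect to a weight measure on $\mathbb R$, and this weight measure is not classical.
   Context: The polynomials $P_{-4,k}(x)$, $k\ge -4$, are defined by $P_{-4,-4}=1$, $P_{-4,-3}=P_{-4,-2}=P_{-4,-1}=0$ and $$(6+2k)P_{-4,k}(x)=4k\,x\,P_{-4,k-2}(x)-2(k-3)P_{-4,k-4}(x),\qquad k\ge 0.$$ All odd-indexed ones vanish. Set $q_n=P_{-4,2n}$, so $q_{-1}=0$, $q_0=1$, $q_1=\frac{4x}{5}$, $q_2=\frac{32x^2-5}{35}$, and $4(n+1)x\,q_n=(2n+5)q_{n+1}+(2n-1)q_{n-1}$ for $n\ge 0$; $q_n$ has degree $n$ for $n\ge 0$. A weight measure $w$ on $\mathbb R$ is a positive Borel measure with finite moments and infinite support; $(p,q)=\int p\,\overline{q}\,dw$ for $p,q\in\mathbb C[x]$. A sequence $\{q_n\}_{n\ge0}$ with $\deg q_n=n$ is orthogonal with respect to $w$ if $(q_n,q_m)=0$ for $n\ne m$. The weight $w$ (or the sequence $\{q_n\}$) is called classical if there exists a second order differential operator $D$ in $x$ with complex polynomial coefficients that is symmetric, i.e. $(Dp,q)=(p,Dq)$ for all $p,q\in\mathbb C[x]$, and such that $Dq_n=\gamma_nq_n$ with $\gamma_n\in\mathbb C$ for all $n\ge 0$. *)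

(* Defs.v *)
From HB Require Import structures.
From mathcomp Require Import all_boot all_order all_algebra.
From mathcomp Require Import all_classical all_reals all_analysis.
From mathcomp Require Import complex.
Set Implicit Arguments.
Unset Strict Implicit.
Unset Printing Implicit Defensive.
Import Order.TTheory GRing.Theory Num.Theory.
Import numFieldNormedType.Exports.
Local Open Scope classical_set_scope.
Local Open Scope ring_scope.

(* [Pm4_shift j] is the polynomial P_{-4, j - 4}; see [Pm4E] for the recurrence
   in the original indexing. *)
Fixpoint Pm4_shift (C : numFieldType) (j : nat) : {poly C} :=
  match j with
  | 0 => 1
  | (k.+2 as k2).+2 =>
      (6 + 2 * k%:R)^-1 *:
        ((4 * k%:R) *: ('X * Pm4_shift C k2)
         - (2 * (k%:R - 3)) *: Pm4_shift C k)
  | _ => 0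
  end.

(* P_{-4, k}; the value for k < -4 is irrelevant. *)
Definition Pm4 (C : numFieldType) (k : int) : {poly C} :=
  if k + 4 is Posz j then Pm4_shift C j else 0.

Lemma Pm4_init (C : numFieldType) :
  [/\ Pm4 C (- 4) = 1, Pm4 C (- 3) = 0, Pm4 C (- 2) = 0 & Pm4 C (- 1) = 0].
Proof. by []. Qed.

Lemma Pm4E (C : numFieldType) (k : int) : 0 <= k ->
  (6 + 2 * k%:~R) *: Pm4 C k =
  (4 * k%:~R) *: ('X * Pm4 C (k - 2)) - (2 * (k%:~R - 3)) *: Pm4 C (k - 4).
Proof.
case: k => // k _; rewrite /Pm4 subrK.
have -> : Posz k - 2 + 4 = Posz k.+2 by rewrite -(addn2 k) PoszD -addrA.
have -> : Posz k + 4 = Posz k.+4 by rewrite -(addn4 k) PoszD.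
have k0 : 6 + 2 * k%:R != 0 :> C.
  by rewrite -natrM -natrD pnatr_eq0.
by rewrite [Pm4_shift C k.+4]/= scalerA mulfV // scale1r.
Qed.

Definition Pm4_even (C : numFieldType) (n : nat) : {poly C} := Pm4 C (n.*2)%:Z.

Section weights.
Variable R : realType.
Local Notation borel_measure :=
  {measure set (measurableTypeR R) -> \bar R}.
Implicit Types w : borel_measure.

Definition msupport w : set R :=
  [set x | forall U : set R, open U -> U x -> (0 < w U)%E].

Definition weight_measure w : Prop :=
  (forall n : nat, w.-integrable setT (fun x : R => (x ^+ n)%:E)) /\
  infinite_set (msupport w).

Definition cintegral w (f : R -> R[i]) : R[i] :=
  Complex (\int[w]_x complex.Re (f x)) (\int[w]_x complex.Im (f x)).

Definition ip w (p q : {poly R[i]}) : R[i] :=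
  cintegral w (fun x => p.[real_complex R x] * conjc q.[real_complex R x]).

Definition orthogonal_polys w (q : nat -> {poly R[i]}) : Prop :=
  (forall n, size (q n) = n.+1) /\
  (forall n m, n != m -> ip w (q n) (q m) = 0).

Definition diffop2 (a2 a1 a0 p : {poly R[i]}) : {poly R[i]} :=
  a2 * p^`(2) + a1 * p^`() + a0 * p.

(* [a2 != 0] expresses that the operator has order exactly two; otherwise the
   identity operator would make every weight classical. *)
Definition classical_weight w (q : nat -> {poly R[i]}) : Prop :=
  exists a2 a1 a0 : {poly R[i]},
    [/\ a2 != 0,
        forall p r, ip w (diffop2 a2 a1 a0 p) r = ip w p (diffop2 a2 a1 a0 r) &
        exists gamma : nat -> R[i],
          forall n, diffop2 a2 a1 a0 (q n) = gamma n *: q n].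

End weights.

(* Main.v *)
Require Import Defs.
From HB Require Import structures.
From mathcomp Require Import all_boot all_order all_algebra.
From mathcomp Require Import all_classical all_reals all_analysis.
From mathcomp Require Import measurable_realfun complex.
From mathcomp Require Import ring lra zify.

Set Implicit Arguments.
Unset Strict Implicit.
Unset Printing Implicit Defensive.
Import Order.TTheory GRing.Theory Num.Theory.
Import numFieldNormedType.Exports.

Local Open Scope classical_set_scope.
Local Open Scope ring_scope.

(** Write q n for the polynomial P_{-4, 2n}.

    Existence of the weight.  The recurrence has the form
    'X * q n.+1 = a n.+1 *: q n.+2 + b n *: q n with a n, b n > 0, so that
    multiplication by 'X is, in the basis q, symmetric for the diagonal form whose
    weights are products of the b i / a i.  The functional L that reads off the
    coordinate on q 0 then satisfies L (q n * q m) = 0 for n != m and L (p ^+ 2) > 0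
    for p != 0 ([jacobi_functional_orthogonal], [jacobi_functional_sqr_gt0]), and
    it remains to represent L by a measure.  Here
    a n * b n = (2n + 5)(2n + 1) / (16 (n + 1)(n + 2)) <= 1/4, so the Jacobi matrix
    has norm at most 1 and L is nonnegative on (1 + 'X) * p ^+ 2 and
    (1 - 'X) * p ^+ 2 ([jacobi_functional_1DX_ge0]), hence on all products
    (1 + 'X) ^+ k * (1 - 'X) ^+ l.  After an affine change of variable this is
    the positivity condition of the Hausdorff moment problem on [0, 1].

    That problem is solved by [hausdorff_moment]: a functional nonnegative on the
    Bernstein polynomials is approximated by discrete measures with masses
    L (bernstein n k) at k / n; their quantile functions are nondecreasing and
    bounded, so they converge pointwise along an ultrafilter to a nondecreasing g,
    and Riemann sums of nondecreasing functions have a uniform error, which lets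
    the moments pass to the limit.  The weight is the image of the uniform measure
    on [0, 1] by 2 * g - 1 ([favard_measure]).  Its support is infinite because no
    nonzero polynomial is null almost everywhere ([infinite_msupport]).

    Absence of classical weights.  An operator a2 * p'' + a1 * p' + a0 * p having
    q 0, ..., q 4 as eigenvectors must have a2 = 0 ([Pm4_even_eigen]): the first
    three conditions force deg a0 <= 0, deg a1 <= 1, deg a2 <= 2, and the last two
    give an inconsistent linear system for the eigenvalues. *)

(** * The moment functional of a three-term recurrence *)

Section JacobiOperator.
Context {F : realFieldType}.
Variables a b : nat -> F.
Implicit Types p u v : {poly F}.

(** If q 0 = 1, 'X * q 0 = a 0 *: q 1 and
    'X * q n.+1 = a n.+1 *: q n.+2 + b n *: q n, multiplication by 'X acts in the
    basis q by the matrix below.  The vector of coordinates is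
    encoded as a polynomial, q n being represented by 'X^n. *)
Definition jacobi u : {poly F} :=
  \poly_(n < (size u).+1)
    ((if n is m.+1 then a m * u`_m else 0) + b n * u`_n.+1).

Lemma coef_jacobi u n :
  (jacobi u)`_n = (if n is m.+1 then a m * u`_m else 0) + b n * u`_n.+1.
Proof.
rewrite coef_poly; case: ltnP => // un.
rewrite (nth_default 0 (n := n.+1)) ?mulr0 ?addr0; last by rewrite ltnW// ltnW.
by case: n un => // n un; rewrite nth_default ?mulr0.
Qed.

Fact jacobi_is_linear : linear jacobi.
Proof.
move=> c u v; apply/polyP => n.
rewrite !(coefD, coefZ, coef_jacobi); case: n => [|n] /=; rewrite ?coefD ?coefZ; ring.
Qed.
HB.instance Definition _ :=
  GRing.isLinear.Build F {poly F} {poly F} _ jacobi jacobi_is_linear.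

Lemma jacobi1 : jacobi 1 = a 0 *: 'X.
Proof.
apply/polyP => -[|[|n]]; rewrite coef_jacobi coefZ !coef1 coefX /=; ring.
Qed.

Lemma jacobiXn n : jacobi 'X^(n.+1) = a n.+1 *: 'X^(n.+2) + b n *: 'X^n.
Proof.
apply/polyP => k; rewrite coef_jacobi coefD !coefZ !coefXn.
case: k => [|k] /=; rewrite ?coefXn ?eqSS.
  by case: n => [|n] /=; ring.
have [->|_] := eqVneq k n.+1; last by case: eqP => [->|_] /=; ring.
have -> : (n.+2 == n) = false by apply/eqP; lia.
by rewrite /=; ring.
Qed.

Lemma size_jacobi u N : (size u <= N)%N -> (size (jacobi u) <= N.+1)%N.
Proof. by move=> uN; apply: leq_trans (size_poly _ _) _. Qed.

(** The coordinates of p in the basis q: p applied to the operator [jacobi], then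
    to the coordinates of q 0. *)
Definition jacobi_coord p : {poly F} :=
  \sum_(i < size p) p`_i *: iter i jacobi 1.

Lemma jacobi_coordE N p : (size p <= N)%N ->
  jacobi_coord p = \sum_(i < N) p`_i *: iter i jacobi 1.
Proof.
move=> pN; rewrite /jacobi_coord (big_ord_widen N (fun i => p`_i *: iter i jacobi 1)) //.
rewrite big_mkcond /=; apply: eq_bigr => i _; case: ltnP => // ip.
by rewrite nth_default ?scale0r.
Qed.

Fact jacobi_coord_is_linear : linear jacobi_coord.
Proof.
move=> c p r; set N := maxn (size p) (size r).
rewrite (@jacobi_coordE N); last first.
  apply: leq_trans (size_polyD _ _) _; rewrite geq_max leq_maxr andbT.
  exact: leq_trans (size_scale_leq _ _) (leq_maxl _ _).
rewrite (@jacobi_coordE N p) ?leq_maxl// (@jacobi_coordE N r) ?leq_maxr//.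
rewrite scaler_sumr -big_split; apply: eq_bigr => i _ /=.
by rewrite coefD coefZ scalerDl scalerA.
Qed.
HB.instance Definition _ :=
  GRing.isLinear.Build F {poly F} {poly F} _ jacobi_coord
    jacobi_coord_is_linear.

Lemma jacobi_coordC c : jacobi_coord c%:P = c%:P.
Proof.
by rewrite (@jacobi_coordE 1) ?size_polyC_leq1// big_ord1 coefC /= alg_polyC.
Qed.

Lemma jacobi_coordXM p : jacobi_coord ('X * p) = jacobi (jacobi_coord p).
Proof.
rewrite (@jacobi_coordE (size p).+1); last first.
  by apply: leq_trans (size_polyMleq _ _) _; rewrite size_polyX.
rewrite big_ord_recl coefXM scale0r add0r /jacobi_coord linear_sum.
by apply: eq_bigr => i _; rewrite linearZ coefXM.
Qed.

(** The squared norm of the n-th orthogonal polynomial, when the 0-th one is 1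
    and the measure has mass 1. *)
Definition jacobi_weight n : F := \prod_(i < n) (b i / a i).
Local Notation h := jacobi_weight.

Definition jacobi_dot u v : F :=
  \sum_(n < size u) h n * (u`_n * v`_n).

Lemma jacobi_dotE N u v : (size u <= N)%N ->
  jacobi_dot u v = \sum_(n < N) h n * (u`_n * v`_n).
Proof.
move=> uN; rewrite /jacobi_dot (big_ord_widen N (fun n => h n * (u`_n * v`_n))) //.
rewrite big_mkcond /=; apply: eq_bigr => i _; case: ltnP => // ip.
by rewrite nth_default ?mul0r ?mulr0.
Qed.

Hypothesis a_gt0 : forall n, 0 < a n.

Let h0 : h 0 = 1. Proof. by rewrite /jacobi_weight big_ord0. Qed.

Let ha n : h n.+1 * a n = h n * b n.
Proof. by rewrite /jacobi_weight big_ord_recr /= -mulrA divfK ?lt0r_neq0. Qed.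

(** The choice of the weights makes h n.+1 * a n and h n * b n agree, so that
    both off-diagonal terms carry the same coefficient; the right-hand side is
    visibly symmetric in u and v. *)
Lemma jacobi_dot_jacobi N u v : (size u <= N)%N -> (size v <= N)%N ->
  jacobi_dot (jacobi u) v =
  \sum_(n < N) h n * b n * (u`_n * v`_n.+1 + u`_n.+1 * v`_n).
Proof.
move=> uN vN; rewrite (@jacobi_dotE N.+1) ?size_jacobi//.
under eq_bigr do rewrite coef_jacobi mulrDl mulrDr.
rewrite big_split /= big_ord_recl big_ord_recr /= mul0r mulr0 add0r.
rewrite [_`_N.+1]nth_default ?(leqW uN)// mulr0 mul0r mulr0 addr0.
rewrite -big_split /=; apply: eq_bigr => i _.
by rewrite /= mulrDr; congr (_ + _); [rewrite -ha|]; ring.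
Qed.

Lemma jacobi_dotC u v : jacobi_dot u v = jacobi_dot v u.
Proof.
rewrite (jacobi_dotE _ (leq_maxl _ (size v))).
rewrite (jacobi_dotE _ (leq_maxr (size u) _)).
by apply: eq_bigr => n _; ring.
Qed.

Lemma jacobi_sym u v : jacobi_dot (jacobi u) v = jacobi_dot u (jacobi v).
Proof.
rewrite [RHS]jacobi_dotC.
rewrite (jacobi_dot_jacobi (leq_maxl _ (size v)) (leq_maxr (size u) _)).
rewrite (jacobi_dot_jacobi (leq_maxr (size u) _) (leq_maxl _ (size v))).
by apply: eq_bigr => n _; ring.
Qed.

Lemma jacobi_dotDl u u' v :
  jacobi_dot (u + u') v = jacobi_dot u v + jacobi_dot u' v.
Proof.
set N := maxn (size u) (size u').
rewrite (@jacobi_dotE N (u + u')); last exact: size_polyD.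
rewrite (@jacobi_dotE N u) ?leq_maxl// (@jacobi_dotE N u') ?leq_maxr//.
by rewrite -big_split; apply: eq_bigr => i _ /=; rewrite coefD; ring.
Qed.

(** The future integral: the functional that sends q 0 to 1 and the other q n
    to 0. *)
Definition jacobi_functional p : F := (jacobi_coord p)`_0.

Fact jacobi_functional_is_scalar : scalar jacobi_functional.
Proof. by move=> c p r; rewrite /jacobi_functional linearP coefD coefZ. Qed.
HB.instance Definition _ :=
  GRing.isLinear.Build F {poly F} F _ jacobi_functional
    jacobi_functional_is_scalar.

(** Multiplication by 'X is symmetric, hence so is multiplication by p, which can
    be moved from one argument of the form to the other. *)
Lemma jacobi_functionalM p r :
  jacobi_functional (p * r) = jacobi_dot (jacobi_coord p) (jacobi_coord r).
Proof.
elim/poly_ind: p r => [|p c IH] r.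
  by rewrite mul0r !linear0 /jacobi_dot size_poly0 big_ord0.
rewrite mulrDl !linearD /= -mulrA IH jacobi_dotDl (mulrC p) !jacobi_coordXM.
rewrite -jacobi_sym; congr (_ + _); rewrite mul_polyC linearZ jacobi_coordC.
rewrite (@jacobi_dotE 1) ?size_polyC_leq1// big_ord1 h0 mul1r coefC /=.
by [].
Qed.

Hypothesis b_gt0 : forall n, 0 < b n.

Lemma jacobi_weight_gt0 n : 0 < h n.
Proof.
elim: n => [|n IH]; first by rewrite h0.
by rewrite -(pmulr_lgt0 _ (a_gt0 n)) ha mulr_gt0.
Qed.

Section Orthogonal.
Variable q : nat -> {poly F}.
Hypothesis q0 : q 0 = 1.
Hypothesis q1 : 'X = a 0 *: q 1.
Hypothesis qS : forall n, 'X * q n.+1 = a n.+1 *: q n.+2 + b n *: q n.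

Lemma jacobi_coord_orthogonal n : jacobi_coord (q n) = 'X^n.
Proof.
suff: jacobi_coord (q n) = 'X^n /\ jacobi_coord (q n.+1) = 'X^(n.+1) by case.
elim: n => [|n [IH0 IH1]]; split=> //.
- by rewrite q0 jacobi_coordC.
- apply: (scalerI (lt0r_neq0 (a_gt0 0))); rewrite -linearZ -q1 /=.
  by rewrite -{1}['X]mulr1 jacobi_coordXM jacobi_coordC jacobi1.
- apply: (scalerI (lt0r_neq0 (a_gt0 n.+1))); apply: (addIr (b n *: 'X^n)).
  by rewrite -jacobiXn -IH1 -jacobi_coordXM qS linearD !linearZ /= IH0.
Qed.

Lemma jacobi_functional_orthogonal n m : n != m ->
  jacobi_functional (q n * q m) = 0.
Proof.
move=> nm; rewrite jacobi_functionalM !jacobi_coord_orthogonal.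
apply: big1 => i _; rewrite !coefXn.
by case: eqP => [->|]; rewrite ?(negbTE nm) ?mul0r ?mulr0.
Qed.

End Orthogonal.

(** Since no a n vanishes, [jacobi] raises the degree by exactly one, and taking
    coordinates preserves degrees. *)
Lemma jacobi_coord_eq0 p : jacobi_coord p = 0 -> p = 0.
Proof.
suff H : p != 0 -> size (jacobi_coord p) = size p.
  move=> E; apply/eqP; apply/negPn/negP => p0; move: (H p0).
  by rewrite E size_poly0 => /esym/eqP; rewrite size_poly_eq0 (negbTE p0).
elim/poly_ind: p => [|p c IH]; first by rewrite eqxx.
have [->|p0 _] := eqVneq p 0.
  by rewrite mul0r add0r jacobi_coordC.
have szT u : u != 0 -> size (jacobi u) = (size u).+1.
  move=> u0; rewrite /jacobi size_poly_eq//.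
  have: (0 < size u)%N by rewrite lt0n size_poly_eq0.
  case E: (size u) => [//|k] _; rewrite [u`_k.+2]nth_default ?E// mulr0 addr0.
  have := u0; rewrite -lead_coef_eq0 lead_coefE E /= => uk.
  by rewrite mulf_neq0// lt0r_neq0.
have p'0 : jacobi_coord p != 0.
  by rewrite -size_poly_eq0 IH// size_poly_eq0.
rewrite linearD /= jacobi_coordC mulrC jacobi_coordXM mulrC.
rewrite size_polyDl szT ?IH//; last first.
  by apply: leq_ltn_trans (size_polyC_leq1 _) _; rewrite ltnS lt0n size_poly_eq0.
rewrite size_polyDl size_mulX//.
by apply: leq_ltn_trans (size_polyC_leq1 _) _; rewrite ltnS lt0n size_poly_eq0.
Qed.

Lemma jacobi_functional_sqr_gt0 p : p != 0 -> 0 < jacobi_functional (p ^+ 2).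
Proof.
move=> p0; rewrite expr2 jacobi_functionalM.
set u := jacobi_coord p.
have u0 : u != 0 by apply: contra_neq p0; exact: jacobi_coord_eq0.
have: (0 < size u)%N by rewrite lt0n size_poly_eq0.
rewrite /jacobi_dot; case E: (size u) => [//|k] _.
rewrite big_ord_recr /=; apply: ltr_wpDl.
  by apply: sumr_ge0 => i _; rewrite mulr_ge0 -?expr2 ?sqr_ge0// ltW// jacobi_weight_gt0.
rewrite mulr_gt0 ?jacobi_weight_gt0// -expr2 lt_neqAle sqr_ge0 andbT eq_sym sqrf_eq0.
by have := u0; rewrite -lead_coef_eq0 lead_coefE E.
Qed.

Hypothesis ab : forall n, a n * b n <= 4^-1.

(** The bound on a n * b n says that the normalized Jacobi matrix has off-diagonal
    entries at most 1/2, hence operator norm at most 1.  Concretely, the quadratic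
    form is a sum of the forms
    h n / 2 * x ^+ 2 + 2 * s * e * x * y + h n.+1 / 2 * y ^+ 2 with e = h n * b n,
    each with nonpositive discriminant. *)
Lemma jacobi_functional_1DX_ge0 s p : s ^+ 2 = 1 ->
  0 <= jacobi_functional ((1 + s *: 'X) * p ^+ 2).
Proof.
move=> s2; rewrite mulrDl mul1r linearD /= -scalerAl linearZ /= expr2 mulrA.
rewrite !jacobi_functionalM jacobi_coordXM; set u := jacobi_coord p.
rewrite (jacobi_dot_jacobi (leqnn (size u)) (leqnn (size u))).
set N := size u; rewrite /jacobi_dot -/N.
(* Every diagonal term is cut into two halves, one for each neighbour; the
   first half of the term of index 0 remains. *)
pose t n := h n * (u`_n * u`_n) / 2.
have tE : \sum_(n < N) h n * (u`_n * u`_n) = t 0%N + \sum_(n < N) (t n + t n.+1).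
  rewrite big_split /= addrA -[t 0%N + _ + _]addrAC.
  have tN : t N = 0 by rewrite /t nth_default// !(mulr0, mul0r).
  rewrite -(big_ord_recl N (fun n => t n)) big_ord_recr /= tN addr0.
  rewrite -big_split /=.
  by apply: eq_bigr => i _; rewrite /t; field.
rewrite tE mulr_sumr -addrA -big_split /=; apply: addr_ge0.
  rewrite /t -expr2 divr_ge0// mulr_ge0 ?sqr_ge0// ltW//.
  exact: jacobi_weight_gt0.
apply: sumr_ge0 => n _; rewrite /t.
have hn := jacobi_weight_gt0 n; have hn1 := jacobi_weight_gt0 n.+1.
set x := u`_n; set y := u`_n.+1; set A := h n; set B := h n.+1.
have e2 : (h n * b n) ^+ 2 <= A * B / 4.
  have -> : (h n * b n) ^+ 2 = A * B * (a n * b n).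
    by rewrite expr2 -{1}ha /A /B; ring.
  by rewrite ler_wpM2l// mulr_ge0// ltW.
set e := _ * b n in e2 *.
(* Complete the square in x. *)
have se2 : (s * e) ^+ 2 <= A * B / 4 by rewrite exprMn s2 mul1r.
set f := s * e in se2.
have -> : A * (x * x) / 2 + B * (y * y) / 2 + s * (e * (x * y + y * x)) =
   A^-1 / 2 * ((A * x + 2 * f * y) ^+ 2 + (A * B - 4 * f ^+ 2) * y ^+ 2).
  by rewrite /f; field; rewrite lt0r_neq0.
rewrite mulr_ge0 ?divr_ge0 ?invr_ge0 ?(ltW hn)//.
by rewrite addr_ge0 ?sqr_ge0// mulr_ge0 ?sqr_ge0//; lra.
Qed.

(** Up to a square, the product is 1, 1 + 'X, 1 - 'X, or (1 + 'X) * (1 - 'X); the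
    last case reduces to the previous two since 2 = (1 - 'X) + (1 + 'X). *)
Lemma jacobi_functional_bernstein_ge0 k l :
  0 <= jacobi_functional ((1 + 'X) ^+ k * (1 - 'X) ^+ l).
Proof.
have splitX (u : {poly F}) m : u ^+ m = u ^+ odd m * (u ^+ m./2) ^+ 2.
  by rewrite -exprM -exprD muln2 odd_double_half.
have plus p : 0 <= jacobi_functional ((1 + 'X) * p ^+ 2).
  have := @jacobi_functional_1DX_ge0 1 p; rewrite scale1r; apply.
  by rewrite expr1n.
have minus p : 0 <= jacobi_functional ((1 - 'X) * p ^+ 2).
  have := @jacobi_functional_1DX_ge0 (- 1) p; rewrite scaleN1r; apply.
  by rewrite sqrrN expr1n.
rewrite (splitX (1 + 'X)) (splitX (1 - 'X)) mulrACA -exprMn.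
set p := _ ^+ k./2 * _; case: (odd k); case: (odd l);
  rewrite ?expr1 ?expr0 ?mulr1 ?mul1r //.
- have -> : (1 + 'X) * (1 - 'X) * p ^+ 2 =
      2^-1 *: ((1 + 'X) * ((1 - 'X) * p) ^+ 2 + (1 - 'X) * ((1 + 'X) * p) ^+ 2).
    apply: (@scalerI _ _ 2); first by rewrite pnatr_eq0.
    by rewrite scalerA divff ?pnatr_eq0// scale1r scaler_nat; ring.
  by rewrite linearZ linearD /= mulr_ge0 ?addr_ge0 ?invr_ge0.
- have [->|p0] := eqVneq p 0; first by rewrite expr0n linear0.
  exact/ltW/jacobi_functional_sqr_gt0.
Qed.

End JacobiOperator.

(** * Integrals of nondecreasing functions *)

Section MonotoneIntegrals.
Context {R : realType}.
Notation mu := (@lebesgue_measure R).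
Implicit Types f : R -> R.

Lemma nondecreasing_integrable f x y : nondecreasing_fun f ->
  mu.-integrable `[x, y] (EFin \o f).
Proof.
move=> ndf; apply: measurable_bounded_integrable => //.
- rewrite /= lebesgue_measure_itv /=; case: ifP => _; rewrite ?ltry//.
- exact: nondecreasing_measurable.
- exists (Num.max `|f x| `|f y|); split; first exact: num_real.
  move=> M HM t /=; rewrite in_itv /= => /andP[xt ty].
  apply: le_trans (ltW HM); rewrite le_max !ler_normr.
  have [ft0|ft0] := leP 0 (f t).
    by rewrite ger0_norm// orbC (le_trans (ndf _ _ ty)) // ?ler_norm.
  by rewrite ltr0_norm// lerN2 (ndf _ _ xt) orbT.
Qed.

Lemma Rintegral_split f x y z : nondecreasing_fun f -> x <= y -> y <= z ->
  \int[mu]_(t in `[x, z]) f t =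
  \int[mu]_(t in `[x, y]) f t + \int[mu]_(t in `[y, z]) f t.
Proof.
move=> ndf xy yz; have fi := nondecreasing_integrable x z ndf.
have := @Rintegral_itvB R f (BLeft x) (BRight z) y fi.
rewrite !bnd_simp => /(_ xy yz).
rewrite Rintegral_itv_obnd_cbnd; last first.
  apply: integrableS (nondecreasing_integrable y z ndf) => //.
  by apply: subset_itvr; rewrite bnd_simp.
by move=> <-; rewrite addrC subrK.
Qed.

Lemma Rintegral_between f x y : nondecreasing_fun f -> x <= y ->
  f x * (y - x) <= \int[mu]_(t in `[x, y]) f t <= f y * (y - x).
Proof.
move=> ndf xy.
have cstE c : c * (y - x) = \int[mu]_(t in `[x, y]) c.
  rewrite Rintegral_cst//= lebesgue_measure_itv /= lte_fin.
  by case: ltgtP xy => // -> _; rewrite subrr.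
rewrite !cstE; apply/andP; split; apply: le_Rintegral => //.
- exact: (@nondecreasing_integrable (cst (f x))).
- exact: nondecreasing_integrable.
- by move=> t /=; rewrite in_itv /= => /andP[xt _]; exact: ndf.
- exact: nondecreasing_integrable.
- exact: (@nondecreasing_integrable (cst (f y))).
- by move=> t /=; rewrite in_itv /= => /andP[_ ty]; exact: ndf.
Qed.

Definition riemann_sum (K : nat) f : R :=
  (\sum_(i < K.+1) f (i%:R / K.+1%:R)) / K.+1%:R.

(** The integral lies between the left and right Riemann sums, whose difference
    telescopes.  What matters is that the bound does not depend on f: it
    replaces dominated convergence when passing to the limit along a filter that
    is not countably generated. *)
Lemma riemann_sum_error K f : nondecreasing_fun f ->
  (forall t, 0 <= f t <= 1) ->
  `|riemann_sum K f - \int[mu]_(t in `[0, 1]) f t| <= K.+1%:R^-1.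
Proof.
move=> ndf f01; pose x (i : nat) : R := i%:R / K.+1%:R.
have K0 : 0 < K.+1%:R :> R by rewrite ltr0n.
have xx i : x i.+1 - x i = K.+1%:R^-1 by rewrite /x -natr1; field; lra.
have xle i : x i <= x i.+1 by rewrite -subr_ge0 xx invr_ge0 ltW.
have bnd n : (\sum_(i < n) f (x i)) / K.+1%:R <= \int[mu]_(t in `[0, x n]) f t
    <= (\sum_(i < n) f (x i.+1)) / K.+1%:R.
  elim: n => [|n /andP[IH1 IH2]].
    by rewrite !big_ord0 /x mul0r set_itv1 Rintegral_set1 lexx.
  rewrite (Rintegral_split (y := x n))//; last by rewrite divr_ge0.
  rewrite !big_ord_recr /= !mulrDl.
  have := Rintegral_between ndf (xle n); rewrite xx => /andP[h1 h2].
  by rewrite !lerD.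
have := bnd K.+1; rewrite /x mulfV ?lt0r_neq0// => /andP[lo up].
have tele : \sum_(i < K.+1) f (x i.+1) + f 0 = \sum_(i < K.+1) f (x i) + f 1.
  have -> : f 1 = f (x K.+1) by rewrite /x mulfV ?lt0r_neq0.
  rewrite -(big_ord_recr K.+1 (fun i => f (x i))) big_ord_recl addrC.
  by rewrite {2}/x mul0r.
have -> : riemann_sum K f = (\sum_(i < K.+1) f (x i)) / K.+1%:R by [].
rewrite ler_distlC; apply/andP; split.
  by apply: le_trans lo; rewrite lerBlDr ler_wpDr// invr_ge0 ltW.
apply: le_trans up _; rewrite -[K.+1%:R^-1 in X in _ <= _ + X]mul1r -mulrDl.
rewrite ler_pM2r ?invr_gt0//.
by move: (f01 0) (f01 1); lra.
Qed.

Section StepFunction.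
Variables (N : nat) (S : nat -> R).
Hypothesis ndS : {homo S : i j / (i <= j)%N >-> i <= j}.

(** A nondecreasing step function equal to k on the interval from S k to
    S k.+1: with S a cumulative distribution, it is a quantile function. *)
Definition step_count (t : R) : nat := \sum_(k < N) (S k.+1 <= t)%R.

Lemma step_count_le t : (step_count t <= N)%N.
Proof.
by rewrite -[leqRHS]card_ord -sum1_card; apply: leq_sum => k _; case: (_ <= _).
Qed.

Lemma nondecreasing_step_count s t : s <= t -> (step_count s <= step_count t)%N.
Proof.
move=> st; apply: leq_sum => k _; have [Ss|//] := leP (S k.+1) s.
by rewrite (le_trans Ss st).
Qed.

Lemma step_countE k t : (k <= N)%N -> S k <= t < S k.+1 -> step_count t = k.
Proof.
move=> kN /andP[kt tk]; rewrite /step_count.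
rewrite (eq_bigr (fun i : 'I_N => (i < k)%N : nat)).
  rewrite -(big_mkord xpredT (fun i => (i < k)%N : nat)) (big_cat_nat (n := k))//=.
  rewrite [X in (_ + X)%N]big_nat [X in (_ + X)%N]big1 ?addn0; last first.
    by move=> i /andP[ki _]; rewrite ltnNge ki.
  rewrite big_nat (eq_bigr (fun=> 1%N)); last by move=> i /andP[_ ->].
  by rewrite -big_nat sum_nat_const_nat subn0 muln1.
move=> i _; congr nat_of_bool; have [ik|ki] := ltnP.
  by rewrite (le_trans _ kt)// ndS.
by apply/negbTE; rewrite -ltNge (lt_le_trans tk)// ndS.
Qed.

Lemma Rintegral_step_count (phi : nat -> R) :
  {homo phi : i j / (i <= j)%N >-> i <= j} ->
  \int[mu]_(t in `[S 0, S N.+1]) phi (step_count t) =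
  \sum_(k < N.+1) (S k.+1 - S k) * phi k.
Proof.
move=> ndphi.
have nd : nondecreasing_fun (phi \o step_count).
  by move=> s t st; apply: ndphi; exact: nondecreasing_step_count.
suff H j : (j <= N.+1)%N -> \int[mu]_(t in `[S 0, S j]) phi (step_count t) =
    \sum_(k < j) (S k.+1 - S k) * phi k by exact: H.
elim: j => [_|j IH jN].
  by rewrite set_itv1 Rintegral_set1 big_ord0.
rewrite (@Rintegral_split (phi \o step_count) _ (S j)) ?ndS//.
rewrite big_ord_recr /= IH ?(ltnW jN)//; congr (_ + _).
rewrite -Rintegral_itv_bndo_bndc; last first.
  apply: integrableS (nondecreasing_integrable (S j) (S j.+1) nd) => //.
  by apply: subset_itvl; rewrite bnd_simp.
rewrite (@eq_Rintegral _ _ _ _ _ (cst (phi j))); last first.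
  move=> t; rewrite inE /= in_itv /= => tj.
  by rewrite (step_countE _ tj).
rewrite Rintegral_cst//= lebesgue_measure_itv /= lte_fin mulrC.
by case: ltgtP (ndS (leqnSn j)) => // -> _; rewrite subrr.
Qed.

End StepFunction.
End MonotoneIntegrals.

(** * The Hausdorff moment problem *)

Section Bernstein.
Context {R : realType}.

Definition bernstein (n k : nat) : {poly R} :=
  'C(n, k)%:R *: ('X^k * (1 - 'X) ^+ (n - k)).

(** The factorial moments of the binomial distribution; unlike the ordinary
    moments they are exact. *)
Lemma sum_bernstein_ffact n m :
  \sum_(k < n.+1) (k ^_ m)%:R *: bernstein n k = (n ^_ m)%:R *: 'X^m.
Proof.
elim: m n => [|m IH] n.
  rewrite ffactn0 expr0 scale1r.
  have <- : (1 - 'X + 'X) ^+ n = 1 :> {poly R} by rewrite subrK expr1n.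
  rewrite exprDn; apply: eq_bigr => k _.
  by rewrite ffactn0 scale1r /bernstein scaler_nat mulrC.
case: n => [|n].
  by rewrite big_ord1 !ffact0n !scale0r.
rewrite big_ord_recl ffact0n scale0r add0r ffactSS natrM -scalerA exprS.
rewrite scalerAr -IH mulr_sumr scaler_sumr; apply: eq_bigr => k _.
rewrite lift0 /bernstein ffactSS subSS -!scalerAr !scalerA (mulrA 'X) -exprS.
congr (_ *: _); rewrite -!natrM; congr (_%:R).
by have := mul_bin_diag n.+1 k; rewrite /=; nia.
Qed.

Lemma expn_ffact_bound N k m : (k <= N)%N ->
  (k ^_ m <= k ^ m)%N /\ (N * k ^ m <= N * k ^_ m + m ^ 2 * N ^ m)%N.
Proof.
move=> kN; elim: m => [|m [IH1 IH2]]; first by rewrite ffactn0 expn0; lia.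
rewrite ffactnSr !expnS; split.
  by rewrite mulnC leq_mul// leq_subr.
have h1 : (k ^_ m * k <= k ^_ m * (k - m) + k ^_ m * m)%N.
  by rewrite -mulnDr leq_mul2l; apply/orP; right; lia.
have h2 : (k ^_ m <= N ^ m)%N.
  by apply: leq_trans IH1 _; case: m {h1 IH2} => [|m] //; rewrite leq_exp2r.
move: IH2 h1 h2 => {IH1}.
move: (k ^ m)%N (k ^_ m)%N (N ^ m)%N => A B D IH2 h1 h2.
have h3 : (N * A * k <= (N * B + m ^ 2 * D) * k)%N by rewrite leq_mul2r IH2 orbT.
have h4 : (m ^ 2 * D * k <= m ^ 2 * D * N)%N by rewrite leq_mul2l kN orbT.
have h5 : (N * (B * k) <= N * (B * (k - m) + B * m))%N by rewrite leq_mul2l h1 orbT.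
have h6 : (N * (B * m) <= N * (D * m))%N by rewrite leq_mul2l leq_mul2r h2 !orbT.
nia.
Qed.

Variable L : {scalar {poly R}}.
Hypothesis L1 : L 1 = 1.
Hypothesis L_ge0 : forall k l, 0 <= L ('X^k * (1 - 'X) ^+ l).

(* The n-th approximation is the discrete measure with mass [weight n k] at
   k / n. *)
Let weight n k := L (bernstein n k).
Let cdf n j := \sum_(k < j) weight n k.

Lemma bernstein_weight_ge0 n k : 0 <= weight n k.
Proof. by rewrite /weight linearZ mulr_ge0. Qed.

Lemma nondecreasing_bernstein_cdf n :
  {homo cdf n : i j / (i <= j)%N >-> i <= j}.
Proof.
apply: homo_leq => [x|y x z|i]; [exact: lexx|exact: le_trans|].
by rewrite /cdf big_ord_recr lerDl bernstein_weight_ge0.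
Qed.

Lemma bernstein_factorial_moment n m :
  \sum_(k < n.+1) (k ^_ m)%:R * weight n k = (n ^_ m)%:R * L 'X^m.
Proof.
rewrite -scalarZ -sum_bernstein_ffact linear_sum.
by apply: eq_bigr => k _; exact/esym/scalarZ.
Qed.

Lemma bernstein_weight_sum n : \sum_(k < n.+1) weight n k = 1.
Proof.
transitivity ((n ^_ 0)%:R * L 'X^0); last by rewrite ffactn0 expr0 L1 mulr1.
rewrite -bernstein_factorial_moment; apply: eq_bigr => k _.
by rewrite ffactn0 mul1r.
Qed.

Lemma bernstein_cdf1 n : cdf n n.+1 = 1.
Proof. exact: bernstein_weight_sum. Qed.

Definition bernstein_moment n m : R :=
  \sum_(k < n.+2) weight n.+1 k * (k%:R / n.+1%:R) ^+ m.

(** With N = n.+1, the m-th moment of the discrete measure differs from its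
    factorial moment divided by N ^ m by at most m ^ 2 / N, and so does
    N ^_ m / N ^ m from 1. *)
Lemma bernstein_moment_error n m :
  `|bernstein_moment n m - L 'X^m| <= (m ^ 2)%:R * (1 + `|L 'X^m|) / n.+1%:R.
Proof.
set N := n.+1; have N0 : 0 < N%:R :> R by rewrite ltr0n.
pose c := (N ^_ m)%:R / N%:R ^+ m : R.
have bnd k : (k <= N)%N ->
    0 <= (k%:R / N%:R : R) ^+ m - (k ^_ m)%:R / N%:R ^+ m <= (m ^ 2)%:R / N%:R.
  move=> kN; have [h1 h2] := expn_ffact_bound m kN.
  have Nm : 0 < N%:R ^+ m :> R by rewrite exprn_gt0.
  rewrite expr_div_n -mulrBl -natrX divr_ge0 ?(ltW Nm) ?subr_ge0 ?ler_nat//=.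
  rewrite ler_pdivrMr// mulrAC ler_pdivlMr// mulrBl lerBlDl.
  by rewrite -[N%:R ^+ m]natrX -!natrM -natrD ler_nat; lia.
have e1 : `|bernstein_moment n m - c * L 'X^m| <= (m ^ 2)%:R / N%:R.
  have -> : c * L 'X^m = \sum_(k < N.+1) weight N k * ((k ^_ m)%:R / N%:R ^+ m).
    rewrite /c mulrAC -bernstein_factorial_moment mulr_suml.
    by apply: eq_bigr => k _; rewrite mulrA (mulrC (weight N k)).
  rewrite /bernstein_moment -sumrB; apply: le_trans (ler_norm_sum _ _ _) _.
  rewrite -[leRHS]mul1r -[X in _ <= X * _](bernstein_weight_sum N) mulr_suml.
  apply: ler_sum => k _; rewrite -mulrBr normrM ger0_norm ?bernstein_weight_ge0//.
  have /andP[b0 b1] := bnd k (ltn_ord k).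
  apply: ler_wpM2l; first exact: bernstein_weight_ge0.
  by rewrite ger0_norm.
have e2 : `|c * L 'X^m - L 'X^m| <= (m ^ 2)%:R / N%:R * `|L 'X^m|.
  rewrite -[X in _ - X]mul1r -mulrBl normrM ler_wpM2r// distrC.
  have /andP[] := bnd N (leqnn N).
  by rewrite divff ?lt0r_neq0// expr1n -/c => b0 b1; rewrite ger0_norm.
rewrite mulrDr mulr1 [leRHS]mulrDl.
apply: le_trans (ler_distD (c * L 'X^m) _ _) _; rewrite lerD//.
by rewrite [leRHS]mulrAC.
Qed.

Lemma cvg_bernstein_moment m : bernstein_moment n m @[n --> \oo] --> L 'X^m.
Proof.
set B := (m ^ 2)%:R * (1 + `|L 'X^m|).
apply/cvgrPdist_le => e e0.
have : B * harmonic n @[n --> \oo] --> B * 0.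
  by apply: cvgM; [exact: cvg_cst|exact: cvg_harmonic].
rewrite mulr0 => /cvgrPdist_le /(_ _ e0); apply: filterS => n /=.
rewrite sub0r normrN => h; rewrite distrC.
apply: le_trans (bernstein_moment_error n m) _.
by apply: le_trans h; exact: ler_norm.
Qed.

Definition bernstein_quantile n (t : R) : R :=
  (step_count n.+1 (cdf n.+1) t)%:R / n.+1%:R.

Lemma bernstein_quantile01 n t : 0 <= bernstein_quantile n t <= 1.
Proof.
rewrite /bernstein_quantile divr_ge0//= ler_pdivrMr ?ltr0n// mul1r ler_nat.
exact: step_count_le.
Qed.

Lemma nondecreasing_bernstein_quantile n :
  nondecreasing_fun (bernstein_quantile n).
Proof.
move=> s t st; rewrite ler_pM2r ?invr_gt0 ?ltr0n// ler_nat.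
by apply: nondecreasing_step_count.
Qed.

Lemma Rintegral_bernstein_quantile n m :
  \int[lebesgue_measure]_(t in `[0, 1]) (bernstein_quantile n t) ^+ m =
  bernstein_moment n m.
Proof.
have S0 : cdf n.+1 0 = 0 by rewrite /cdf big_ord0.
rewrite -{1}S0 -(bernstein_cdf1 n.+1).
rewrite (@Rintegral_step_count _ n.+1 _ (@nondecreasing_bernstein_cdf n.+1)
  (fun k => (k%:R / n.+1%:R) ^+ m)); last first.
  move=> i j ij; rewrite lerXn2r ?nnegrE ?divr_ge0//.
  by rewrite ler_pM2r ?invr_gt0 ?ltr0n// ler_nat.
apply: eq_bigr => k _; congr (_ * _).
by rewrite /cdf big_ord_recr /= addrAC subrr add0r.
Qed.

End Bernstein.

(** Used to extract the limit of a sequence of functions at all points at once,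
    without a diagonal argument. *)
Lemma ultra_bounded_cvg {R : realType} {I : Type} (F : set_system I)
    (u : I -> R) (a b : R) : UltraFilter F -> (forall i, a <= u i <= b) ->
  exists2 l, a <= l <= b & u @ F --> l.
Proof.
move=> FU uab.
have [|l [lab ucl]] := @segment_compact R a b (u @ F) _.
  by apply: (@filterE _ F) => i; rewrite /= in_itv; exact: uab.
exists l; first by move: lab; rewrite /= in_itv.
move=> V Vl; have [//|FnV] := in_ultra_setVsetC (u @^-1` V) FU.
by have [x []] := ucl (~` V) V FnV Vl.
Qed.

Lemma nondecreasing_exprn {R : realType} (f : R -> R) m :
  nondecreasing_fun f -> (forall t, 0 <= f t) ->
  nondecreasing_fun (fun t => f t ^+ m).
Proof. by move=> ndf f0 s t st; rewrite lerXn2r ?nnegrE// ndf. Qed.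

(** The approximating discrete measures are images of the Lebesgue measure by
    their quantile functions, which take values in [0, 1] and hence converge
    pointwise along an ultrafilter.  The limit g is again nondecreasing, and a
    Riemann sum of g ^ m is the limit of the Riemann sums of the m-th powers of
    the quantile functions; since the error of a Riemann sum is uniform, the
    integrals converge as well.  The measure with the given moments is the image
    of the Lebesgue measure by g. *)
Theorem hausdorff_moment {R : realType} (L : {scalar {poly R}}) :
  L 1 = 1 -> (forall k l, 0 <= L ('X^k * (1 - 'X) ^+ l)) ->
  exists g : R -> R, [/\ nondecreasing_fun g, forall t, 0 <= g t <= 1 &
    forall m, \int[lebesgue_measure]_(t in `[0, 1]) g t ^+ m = L 'X^m].
Proof.
move=> L1 L0; pose u n t := bernstein_quantile L n t.
have u01 n t : 0 <= u n t <= 1 by exact: bernstein_quantile01.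
have [U [UU ooU]] := @ultraFilterLemma nat \oo _.
have gP t : exists l : R, 0 <= l <= 1 /\ u n t @[n --> U] --> l.
  by have [l ? ?] := ultra_bounded_cvg UU (fun n => u01 n t); exists l.
pose g t := projT1 (cid (gP t)).
have g01 t : 0 <= g t <= 1 by have [] := projT2 (cid (gP t)).
have ug t : u n t @[n --> U] --> g t by have [] := projT2 (cid (gP t)).
have ndg : nondecreasing_fun g.
  move=> s t st; apply: ler_cvg_to (ug s) (ug t) _.
  by apply: filterE => n; exact: nondecreasing_bernstein_quantile.
exists g; split=> // m.
have ndgm : nondecreasing_fun (fun t => g t ^+ m).
  by apply: nondecreasing_exprn => // t; case/andP: (g01 t).
have pow01 (x : R) : 0 <= x <= 1 -> 0 <= x ^+ m <= 1.
  by move=> /andP[x0 x1]; rewrite exprn_ge0//= exprn_ile1.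
have step K : `|riemann_sum K (fun t => g t ^+ m) - L 'X^m| <= K.+1%:R^-1.
  have ucvg : riemann_sum K (fun t => u n t ^+ m) @[n --> U] -->
      riemann_sum K (fun t => g t ^+ m).
    apply: cvgM; last exact: cvg_cst.
    apply: cvg_big => [|i _]; first exact: add_continuous.
    exact: (cvg_comp _ _ (ug _) (@exprn_continuous R m _)).
  have mcvg : bernstein_moment L n m @[n --> U] --> L 'X^m.
    by move=> V /(cvg_bernstein_moment L1 L0); exact: ooU.
  have ccvg : (K.+1%:R^-1 : R) @[_ --> U] --> (K.+1%:R^-1 : R) by exact: cvg_cst.
  have dcvg : `|riemann_sum K (fun t => u n t ^+ m) - bernstein_moment L n m|
      @[n --> U] --> `|riemann_sum K (fun t => g t ^+ m) - L 'X^m|.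
    exact: cvg_norm (cvgB ucvg mcvg).
  apply: ler_cvg_to dcvg ccvg _; apply: filterE => n.
  rewrite -Rintegral_bernstein_quantile//.
  apply: riemann_sum_error => [|t]; last exact/pow01/u01.
  apply: nondecreasing_exprn; first exact: nondecreasing_bernstein_quantile.
  by move=> t; case/andP: (u01 n t).
apply/eqP; rewrite -subr_eq0 -normr_le0; apply/ler_addgt0Pr => e e0.
have /cvgrPdist_lt /(_ _ (divr_gt0 e0 (ltr0n R 2))) [K _ /(_ K (leqnn K))] :=
  @cvg_harmonic R.
rewrite sub0r normrN ger0_norm ?harmonic_ge0// add0r => Ke.
apply: le_trans (ler_distD (riemann_sum K (fun t => g t ^+ m)) _ _) _.
rewrite (splitr e) lerD//; last exact: le_trans (step K) (ltW Ke).
rewrite distrC; apply: le_trans (ltW Ke).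
by apply: riemann_sum_error => // t; exact/pow01/g01.
Qed.

(** * Measures determined by integrals of polynomials *)

Section PolynomialIntegrals.
Context {R : realType}.
Notation TR := (measurableTypeR R).

Lemma measurable_horner (p : {poly R}) :
  measurable_fun [set: TR] (fun x : R => p.[x]).
Proof. by apply: continuous_measurable_fun; exact: continuous_horner. Qed.

Lemma integral_horner d (T : measurableType d) (mu : {measure set T -> \bar R})
    (g : T -> R) (L : {scalar {poly R}}) :
  (forall m, mu.-integrable setT (EFin \o (fun t => g t ^+ m))) ->
  (forall m, \int[mu]_t g t ^+ m = L 'X^m) ->
  forall p : {poly R}, mu.-integrable setT (EFin \o (fun t => p.[g t])) /\
    \int[mu]_t p.[g t] = L p.
Proof.
move=> gi gL p; rewrite -[p]coefK poly_def.
elim: (size p) => [|n [IHi IHL]].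
  rewrite big_ord0 linear0; have -> : (fun t => (0 : {poly R}).[g t]) = cst 0.
    by apply/funext => t; rewrite horner0.
  by split; [exact: integrable0|rewrite Rintegral_cst// mul0r].
rewrite big_ord_recr /=; set u := \sum_(i < n) _ in IHi IHL *.
have -> : (fun t => (u + p`_n *: 'X^n).[g t]) =
    (fun t => u.[g t] + p`_n * g t ^+ n).
  by apply/funext => t; rewrite hornerD hornerZ hornerXn.
have zi : mu.-integrable setT (EFin \o (fun t => p`_n * g t ^+ n)).
  by have := integrableZl measurableT (p`_n) (gi n).
split; first by have := integrableD measurableT IHi zi.
by rewrite RintegralD// IHL RintegralZl// gL linearD linearZ.
Qed.

(** The complement of the support is the union of the null open intervals with
    rational endpoints, a countable family. *)
Lemma msupport_compl_negligible (w : {measure set TR -> \bar R}) :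
  w.-negligible (~` msupport w).
Proof.
pose F (n : nat) : set R :=
  if unpickle n is Some (a, b)
  then if w `]ratr a, ratr b[%classic == 0%E then `]ratr a, ratr b[%classic
       else set0
  else set0.
have : w.-negligible (\bigcup_n F n).
  apply: negligible_bigcup => n; rewrite /F.
  case: (unpickle n) => [[a b]|]; last exact: negligible_set0.
  case: eqP => [w0|_]; last exact: negligible_set0.
  by exists (`]ratr a, ratr b[%classic : set R); split=> //; exact: measurable_itv.
apply: negligibleS => x /existsNP[U] /not_implyP[oU] /not_implyP[Ux] /negP.
rewrite lt0e measure_ge0 andbT negbK => /eqP wU0.
have /nbhs_ballP[e /= e0 eU] : nbhs x U by exact: open_nbhs_nbhs.
have /rat_in_itvoo[a] : x - e < x by rewrite ltrBlDr ltrDl.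
have /rat_in_itvoo[b] : x < x + e by rewrite ltrDl.
rewrite !in_itv /= => /andP[xb be] /andP[ea ax].
exists (pickle (a, b)); first exact: Logic.I.
rewrite /F pickleK.
have abU : `]ratr a, ratr b[%classic `<=` U.
  move=> y /=; rewrite in_itv /= => /andP[ay yb]; apply: eU.
  by rewrite /ball /= ltr_distlC; apply/andP; split; lra.
rewrite ifT; first by rewrite /= in_itv /= ax xb.
rewrite -measure_le0 -wU0 le_measure ?inE//.
exact: open_measurable.
Qed.

(** If the support were finite, the polynomial vanishing exactly on it would be
    null almost everywhere. *)
Lemma infinite_msupport (w : {measure set TR -> \bar R}) :
  (forall p : {poly R}, p != 0 -> \int[w]_x (p ^+ 2).[x] != 0) ->
  infinite_set (msupport w).
Proof.
move=> wpos /finite_seqP[s sE].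
pose p := \prod_(a <- s) ('X - a%:P).
have p0 : p != 0 by apply: monic_neq0; exact: monic_prod_XsubC.
have /eqP := wpos p p0; apply.
rewrite /Rintegral (@ae_eq_integral _ _ _ w setT (cst 0%E)) ?integral0//.
  by apply/measurable_EFinP; exact: measurable_horner.
apply: negligibleS (msupport_compl_negligible w) => x /= nx.
rewrite sE => xs; apply: nx => _; congr (_%:E).
by rewrite horner_exp (rootP _) ?expr0n// root_prod_XsubC.
Qed.

End PolynomialIntegrals.

Section Favard.
Context {R : realType}.
Notation TR := (measurableTypeR R).
Variables a b : nat -> R.
Hypothesis a_gt0 : forall n, 0 < a n.
Hypothesis b_gt0 : forall n, 0 < b n.
Hypothesis ab : forall n, a n * b n <= 4^-1.

Notation L := (jacobi_functional a b).

(** Favard's theorem, for coefficients that force the measure to live on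
    [-1, 1]: transported to [0, 1], the functional is nonnegative on the
    Bernstein polynomials, so that it is a Hausdorff moment functional. *)
Theorem favard_measure : exists w : {measure set TR -> \bar R},
  forall p : {poly R}, w.-integrable setT (EFin \o (fun x : R => p.[x])) /\
    \int[w]_x p.[x] = L p.
Proof.
(* The affine bijection from [-1, 1] to [0, 1]; its inverse is 2 * 'X - 1. *)
pose rescale : {poly R} := 2^-1 *: (1 + 'X).
pose L' p := L (p \Po rescale).
have L'lin : scalar L'.
  by move=> c p r; rewrite /L' comp_polyD comp_polyZ linearP.
pose L's : {scalar {poly R}} := HB.pack L' (GRing.isLinear.Build _ _ _ _ L' L'lin).
have L'1 : L's 1 = 1.
  rewrite /= /L' -polyC1 comp_polyC /jacobi_functional /jacobi_coord.
  rewrite size_polyC oner_neq0 big_ord1 coefC /= scale1r coef1.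
  by [].
have L'ge0 k l : 0 <= L's ('X^k * (1 - 'X) ^+ l).
  rewrite /= /L' rmorphM !rmorphXn rmorphB /= comp_polyX -polyC1 comp_polyC polyC1.
  have -> : 1 - rescale = 2^-1 *: (1 - 'X).
    rewrite /rescale scalerDr scalerBr opprD addrA; congr (_ - _).
    by rewrite -{1}[1]scale1r -scalerBl; congr (_ *: _); lra.
  rewrite /rescale !exprZn -scalerAl -scalerAr !linearZ /=.
  rewrite !mulr_ge0 ?exprn_ge0 ?invr_ge0//.
  exact: jacobi_functional_bernstein_ge0.
have [g [ndg g01 gL]] := hausdorff_moment L'1 L'ge0.
pose P := uniform_prob (@ltr01 R).
have mg : measurable_fun setT (g : TR -> TR) by exact: nondecreasing_measurable.
have mgX m : measurable_fun setT (EFin \o (fun t : TR => g t ^+ m)).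
  by apply/measurable_EFinP; exact: measurable_funX.
have gX01 m t : 0 <= g t ^+ m <= 1.
  by have /andP[g0 g1] := g01 t; rewrite exprn_ge0//= exprn_ile1.
have gi m : P.-integrable setT (EFin \o (fun t : TR => g t ^+ m)).
  apply: (@le_integrable _ _ _ _ _ measurableT _ (cst 1%E)) => //.
    move=> t _ /=; rewrite lee_fin normr1.
    by have /andP[? ?] := gX01 m t; rewrite ger0_norm.
  exact: finite_measure_integrable_cst.
have gP m : \int[P]_t g t ^+ m = L's 'X^m.
  rewrite -gL /Rintegral integral_uniform; first by rewrite subr0 invr1 mul1e.
    exact: mgX.
  by move=> t; rewrite lee_fin; case/andP: (gX01 m t).
pose f : TR -> TR := fun t => 2 * g t - 1.
have mf : measurable_fun setT f.
  by apply: measurable_funB => //; exact: measurable_funM.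
have fE p t : p.[f t] = (p \Po (2 *: 'X - 1)).[g t].
  by rewrite horner_comp -polyC1 !hornerE.
exists (pushforward P f) => p.
have [pi pL] := integral_horner gi gP (p \Po (2 *: 'X - 1)).
have mp : measurable_fun [set: TR] (EFin \o (fun x : R => p.[x])).
  by apply/measurable_EFinP; exact: measurable_horner.
have pi' : P.-integrable (f @^-1` setT) ((EFin \o (fun x : R => p.[x])) \o f).
  rewrite preimage_setT; move: pi; congr (P.-integrable _ _).
  by apply/funext => t /=; rewrite fE.
split; first exact: integrable_pushforward.
rewrite /Rintegral integral_pushforward//.
transitivity (\int[P]_t (p \Po (2 *: 'X - 1)).[g t]).
  rewrite /Rintegral preimage_setT; congr fine.
  by apply: eq_integral => t _ /=; rewrite fE.
rewrite pL /= /L' -comp_polyA.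
rewrite [X in _ \Po X](_ : _ = 'X) ?comp_polyXr//.
rewrite comp_polyB comp_polyZ comp_polyX -polyC1 comp_polyC polyC1 /rescale.
by rewrite scalerA divff ?pnatr_eq0// scale1r addrAC subrr add0r.
(* The measure structure of the pushforward rests on the measurability of f. *)
Unshelve. exact: mf.
Qed.
End Favard.

(** * The polynomials q n = P_{-4, 2n} and second order operators *)

Section Recurrence.
Variable C : numFieldType.
Local Notation q := (Pm4_even C).

Lemma Pm4_even0 : q 0 = 1.
Proof.
have := @Pm4E C 0 isT.
have -> : Pm4 C (0 - 4) = 1 by [].
have -> : Pm4 C (0 - 2) = 0 by [].
rewrite (mulr0 'X) scaler0 sub0r -scaleNr -/(q 0) => E.
have d0 : 6 + 2 * 0%:~R != 0 :> C by rewrite mulr0 addr0 pnatr_eq0.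
by apply: (scalerI d0); rewrite E; congr (_ *: _); ring.
Qed.

Lemma Pm4_even_rec n :
  (2 * n%:R + 7) *: q n.+2 =
  (4 * n.+2%:R) *: ('X * q n.+1) - (2 * n%:R + 1) *: q n.
Proof.
have := @Pm4E C (n.+2).*2%:Z isT.
have -> : (n.+2).*2%:Z - 2 = n.+1.*2%:Z by rewrite !doubleS; lia.
have -> : (n.+2).*2%:Z - 4 = n.*2%:Z by rewrite !doubleS; lia.
rewrite -/(q n.+2) -/(q n.+1) -/(q n) => E.
(* The terms q _ compute, so they are abstracted before rewriting. *)
move: (q n.+2) (q n.+1) (q n) E => u v w E.
have two0 : 2 != 0 :> C by rewrite pnatr_eq0.
apply: (scalerI two0); rewrite scalerBr !scalerA.
have dE : n.+2.*2%:~R = 2 * n%:R + 4 :> C.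
  by rewrite -mul2n -pmulrn natrM -(addn2 n) natrD; ring.
have -> : 2 * (2 * n%:R + 7) = 6 + 2 * n.+2.*2%:~R :> C by rewrite dE; ring.
rewrite E dE -(addn2 n) natrD; congr (_ *: _ - _ *: _); ring.
Qed.

Lemma Pm4_even1 : q 1 = (4 / 5) *: ('X : {poly C}).
Proof.
have := @Pm4E C 2 isT.
have -> : Pm4 C (2 - 4) = 0 by [].
have -> : Pm4 C (2 - 2) = 1 := Pm4_even0.
rewrite scaler0 subr0 mulr1 -/(q 1) => E.
have d0 : 6 + 2 * 2%:~R != 0 :> C by rewrite -natrM -natrD pnatr_eq0.
by apply: (scalerI d0); rewrite E scalerA; congr (_ *: _); field.
Qed.

(** The equations for q 0, q 1, q 2 determine a0, a1 and a2 from the eigenvalues;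
    then the equations for q 3 and q 4, evaluated at a few points, form a linear
    system in the differences g n = gamma n - gamma 0 whose only solution is
    zero. *)
Lemma Pm4_even_eigen (a2 a1 a0 : {poly C}) (gamma : nat -> C) :
  (forall n, a2 * (q n)^`(2) + a1 * (q n)^`() + a0 * q n = gamma n *: q n) ->
  a2 = 0.
Proof.
move=> eigen.
have solve n (u : {poly C}) : (2 * n%:R + 7) *: q n.+2 = u ->
    q n.+2 = (2 * n%:R + 7)^-1 *: u.
  by move: (q n.+2) => v <-; rewrite scalerA mulVf ?scale1r.
have q2 := solve _ _ (Pm4_even_rec 0); have q3 := solve _ _ (Pm4_even_rec 1).
have q4 := solve _ _ (Pm4_even_rec 2).
rewrite Pm4_even0 Pm4_even1 in q2; rewrite q2 Pm4_even1 in q3.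
rewrite q3 q2 in q4.
have E n x : a2.[x] * (q n)^`()^`().[x] + a1.[x] * (q n)^`().[x]
    + a0.[x] * (q n).[x] = gamma n * (q n).[x].
  by have := congr1 (horner^~ x) (eigen n); rewrite !hornerE.
have d1 : (1 : {poly C})^`() = 0 by rewrite -polyC1 derivC.
have d0 : (0 : {poly C})^`() = 0 by rewrite linear0.
have h1 x : (1 : {poly C}).[x] = 1 by rewrite -polyC1 hornerC.
have hE := (h1, horner0, hornerD, hornerN, hornerM, hornerZ, hornerX, hornerC).
have comb1 c L M A B : A - B = c * (L - M) -> L = M -> A = B :> C.
  by move=> AB LM; apply/eqP; rewrite -subr_eq0 AB LM subrr mulr0.
have E0 x : a0.[x] = gamma 0.
  by have := E 0 x; rewrite Pm4_even0 d1 d0 !hE !(mulr0, add0r, mulr1).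
pose g n := gamma n - gamma 0.
have E1 x : a1.[x] = g 1 * x.
  have := E 1 x; rewrite Pm4_even1 E0 !(poly.derivE, d1, d0) !hE.
  by apply: (@comb1 (5 / 4)); rewrite /g; field.
have E2 x : a2.[x] = g 2 * (32 * x ^+ 2 - 5) / 64 - g 1 * x ^+ 2.
  have := E 2 x; rewrite q2 E0 E1 !(poly.derivE, d1, d0) !hE.
  by apply: (@comb1 (35 / 64)); rewrite /g; field.
have E3 x : (g 2 * (32 * x ^+ 2 - 5) / 64 - g 1 * x ^+ 2) * (48 * x)
   + g 1 * x * (24 * x ^+ 2 - 3) = g 3 * (8 * x ^+ 3 - 3 * x).
  have := E 3 x; rewrite q3 E0 E1 E2 !(poly.derivE, d1, d0) !hE.
  by apply: (@comb1 (105 / 16)); rewrite /g; field.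
have E4 x : (g 2 * (32 * x ^+ 2 - 5) / 64 - g 1 * x ^+ 2) * (768 * x ^+ 2 - 78)
   + g 1 * x * (256 * x ^+ 3 - 78 * x)
   = g 4 * (64 * x ^+ 4 - 39 * x ^+ 2 + 75 / 32).
  have := E 4 x; rewrite q4 E0 E1 E2 !(poly.derivE, d1, d0) !hE.
  by apply: (@comb1 (1155 / 32)); rewrite /g; field.
have comb2 c d L M L' M' A B : A - B = c * (L - M) + d * (L' - M') ->
    L = M -> L' = M' -> A = B :> C.
  move=> AB LM LM'; apply/eqP.
  by rewrite -subr_eq0 AB LM LM' !subrr !mulr0 addr0.
(* q 3 is odd: the values at 1 and 1 / 2 suffice to eliminate g 3.  The value of
   the equation for q 4 at 0 gives g 4, and the value at 1 / 2 then gives a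
   ratio of g 1 to g 2 incompatible with the one obtained from q 3. *)
have g12 : g 1 = 7 / 16 * g 2.
  by move: (E3 1) (E3 2^-1); apply: (@comb2 (- (1 / 72)) (- (5 / 36))); field.
have g4 : g 4 = 13 / 5 * g 2.
  by move: (E4 0); apply: (@comb1 (- (32 / 75))); field.
have g12' : g 1 = 71 / 160 * g 2.
  by move: (E4 2^-1); rewrite g4; apply: (@comb1 (- (1 / 32))); field.
have g2 : g 2 = 0.
  by move: g12 g12'; apply: (@comb2 160 (- 160)); field.
have a2x x : a2.[x] = 0 by rewrite E2 g12 g2 !(mulr0, mul0r) subrr.
(* A polynomial that vanishes on the natural numbers is zero. *)
apply: (@roots_geq_poly_eq0 _ _ (mkseq (fun n => n%:R) (size a2))).
- by apply/allP => x _; rewrite rootE a2x.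
- by rewrite map_inj_uniq ?iota_uniq// => i j /eqP; rewrite eqr_nat => /eqP.
- by rewrite size_mkseq.
Qed.
End Recurrence.

Lemma Pm4_even_map (F K : numFieldType) (f : {rmorphism F -> K}) n :
  map_poly f (Pm4_even F n) = Pm4_even K n.
Proof.
suff: map_poly f (Pm4_even F n) = Pm4_even K n /\
    map_poly f (Pm4_even F n.+1) = Pm4_even K n.+1 by case.
elim: n => [|n [IH0 IH1]]; split=> //.
- by rewrite !Pm4_even0 rmorph1.
- rewrite !Pm4_even1 map_polyZ; congr (_ *: _); last exact: map_polyX.
  by rewrite /= rmorphM fmorphV !rmorph_nat.
have d0 : 2 * n%:R + 7 != 0 :> K.
  by rewrite -natrM -natrD pnatr_eq0 addn_eq0 andbF.
apply: (scalerI d0); rewrite Pm4_even_rec -IH0 -IH1.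
have -> : 2 * n%:R + 7 = f (2 * n%:R + 7) by rewrite rmorphD rmorphM !rmorph_nat.
rewrite -map_polyZ Pm4_even_rec rmorphB /= !map_polyZ.
have -> : f (4 * n.+2%:R) = 4 * n.+2%:R by rewrite rmorphM !rmorph_nat.
have -> : f (2 * n%:R + 1) = 2 * n%:R + 1.
  by rewrite rmorphD rmorphM !rmorph_nat rmorph1.
by congr (_ *: _ - _); rewrite rmorphM; congr (_ * _); exact: map_polyX.
Qed.

(** * Orthogonality *)

Section Pm4Orthogonality.
Context {R : realType}.
Notation C := R[i].
Notation TR := (measurableTypeR R).
Notation toC := (real_complex R).
Notation q := (Pm4_even R).

Lemma Pm4_even_complex n : Pm4_even C n = map_poly toC (q n).
Proof. exact/esym/Pm4_even_map. Qed.

Lemma ip_real (w : {measure set TR -> \bar R}) (p r : {poly R}) :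
  ip w (map_poly toC p) (map_poly toC r) = toC (\int[w]_x (p * r).[x]).
Proof.
rewrite /ip /cintegral; apply/eqP; rewrite eq_complex /=.
have E x : (map_poly toC p).[toC x] * conjc (map_poly toC r).[toC x] =
    toC ((p * r).[x]).
  by rewrite !horner_map /= hornerM rmorphM /= oppr0.
under eq_Rintegral do rewrite E /=.
under [X in _ && (X == _)]eq_Rintegral do rewrite E /=.
by rewrite eqxx /= Rintegral_cst// mul0r eqxx.
Qed.

(* The coefficients of 'X * q n on q n.+1 and of 'X * q n.+1 on q n. *)
Let a (n : nat) : R := (2 * n%:R + 5) / (4 * n.+1%:R).
Let b (n : nat) : R := (2 * n%:R + 1) / (4 * n.+2%:R).

Let a_gt0 n : 0 < a n.
Proof. by rewrite divr_gt0// ltr_wpDl// mulr_ge0. Qed.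

Let b_gt0 n : 0 < b n.
Proof. by rewrite divr_gt0// ltr_wpDl// mulr_ge0. Qed.

(* With n in the role of a real variable, the inequality reads
   4n^2 + 12n + 5 <= 4n^2 + 12n + 8. *)
Let ab n : a n * b n <= 4^-1.
Proof.
rewrite /a /b mulf_div ler_pdivrMr ?mulr_gt0//.
have : 0 <= n%:R :> R by [].
have -> : n.+2%:R = n%:R + 2 :> R by rewrite -natrD addn2.
have -> : n.+1%:R = n%:R + 1 :> R by rewrite natr1.
by move: (n%:R) => x x0; nra.
Qed.

Lemma Pm4_even_X1 : 'X = a 0 *: q 1.
Proof.
rewrite Pm4_even1 scalerA -[LHS]scale1r; congr (_ *: _).
by rewrite /a mulr0 add0r mulr1; field.
Qed.

Lemma Pm4_even_XS n : 'X * q n.+1 = a n.+1 *: q n.+2 + b n *: q n.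
Proof.
have n2 : 4 * n.+2%:R != 0 :> R by rewrite mulf_neq0 ?pnatr_eq0.
have := Pm4_even_rec R n.
move: (q n.+2) (q n.+1) (q n) => u v w uvw.
apply: (scalerI n2); rewrite scalerDr !scalerA.
have -> : 4 * n.+2%:R * a n.+1 = 2 * n%:R + 7.
  by rewrite /a mulrC divfK// -(addn1 n) natrD; ring.
have -> : 4 * n.+2%:R * b n = 2 * n%:R + 1 by rewrite /b mulrC divfK.
by rewrite uvw subrK.
Qed.

Lemma size_Pm4_even n : size (Pm4_even C n) = n.+1.
Proof.
rewrite Pm4_even_complex size_map_poly.
suff: size (q n) = n.+1 /\ size (q n.+1) = n.+2 by case.
elim: n => [|n [IH0 IH1]]; split=> //.
- by rewrite Pm4_even0 size_polyC oner_neq0.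
- by rewrite Pm4_even1 size_scale ?size_polyX// mulf_neq0 ?invr_eq0 ?pnatr_eq0.
have q0 : q n.+1 != 0 by rewrite -size_poly_eq0 IH1.
have := congr1 (fun p : {poly R} => size p) (Pm4_even_XS n).
rewrite mulrC size_mulX// IH1 => E.
have := size_scale (q n.+2) (lt0r_neq0 (a_gt0 n.+1)).
have := size_scale (q n) (lt0r_neq0 (b_gt0 n)); rewrite IH0 => sb <-.
have [/size_polyDl <-//|ab_le] :=
  ltnP (size (b n *: q n)) (size (a n.+1 *: q n.+2)).
have := size_polyD (a n.+1 *: q n.+2) (b n *: q n).
by rewrite -E (maxn_idPr ab_le) sb; lia.
Qed.

Theorem Pm4_even_orthogonal : exists w : {measure set TR -> \bar R},
  weight_measure w /\ orthogonal_polys w (Pm4_even C).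
Proof.
have [w wL] := favard_measure a_gt0 b_gt0 ab; exists w.
split; split.
- move=> n; have [+ _] := wL 'X^n; congr (_.-integrable _ _).
  by apply/funext => x /=; rewrite hornerXn.
- apply: infinite_msupport => p p0; have [_ ->] := wL (p ^+ 2).
  by rewrite lt0r_neq0// (@jacobi_functional_sqr_gt0 _ a b).
- exact: size_Pm4_even.
- move=> n m nm; rewrite !Pm4_even_complex ip_real; have [_ ->] := wL (q n * q m).
  rewrite (@jacobi_functional_orthogonal _ a b _ q) ?rmorph0//.
  + exact: Pm4_even0.
  + exact: Pm4_even_X1.
  + exact: Pm4_even_XS.
Qed.

End Pm4Orthogonality.

Theorem corollary4p0p2 (R : realType) :
  (exists w : {measure set (measurableTypeR R) -> \bar R},
      weight_measure w /\ orthogonal_polys w (Pm4_even R[i])) /\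
  (forall w : {measure set (measurableTypeR R) -> \bar R},
      weight_measure w -> orthogonal_polys w (Pm4_even R[i]) ->
      ~ classical_weight w (Pm4_even R[i])).
Proof.
split; first exact: Pm4_even_orthogonal.
move=> w _ _ [a2 [a1 [a0 [a2_neq0 _ [gamma eigen]]]]].
by move/eqP: a2_neq0; apply; exact: Pm4_even_eigen eigen.
Qed.
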